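(* Let $A$ be a locally $AW^{*}$-algebra. Then its bounded part $b(A)$ is an $AW^{*}$-algebra (in the norm $\|\cdot\|_\infty$), and $b(A)$ is dense in $A$ in the projective topology of $A$.
   Context: All algebras are associative over $\mathbb{C}$. A locally $C^{*}$-algebra is a topological $^{*}$-algebra topologically $^{*}$-isomorphic to a Hausdorff projective limit of a projective family of $C^{*}$-algebras with continuous $^{*}$-homomorphisms as connecting maps over a directed index set; equivalently, a complete Hausdorff topological $^{*}$-algebra whose topology (the projective topology) is generated by a saturated separating family of $C^{*}$-seminorms. A $C^{*}$-seminorm is a submultiplicative seminorm with $\|a^{*}a\|=\|a\|^2$. $N(A)$ denotes the set of all continuous $C^{*}$-seminorms on $A$. An element $a\in A$ is bounded if $\|a\|_\infty=\sup\{\|a\|_\alpha : \|\cdot\|_\alpha\in N(A)\}<\infty$; $b(A)$ is the set of all bounded elements. A projection is a self-adjoint idempotent. For a nonempty subset $S$ of a $^{*}$-algebra $A$, $R(S)=\{x\in A: sx=0\ \forall s\in S\}$. $A$ is a Baer $^{*}$-algebra if for each nonempty $S\subset A$ there is a projection $g\in A$ with $R(S)=gA$. An $AW^{*}$-algebra is a $C^{*}$-algebra that is a Baer $^{*}$-algebra. A locally $AW^{*}$-algebra is a locally $C^{*}$-algebra that is a Baer $^{*}$-algebra. *)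

(* Defs.v *)
From HB Require Import structures.
From mathcomp Require Import all_boot all_order all_algebra.
From mathcomp Require Import complex.
From mathcomp Require Import all_classical all_reals all_analysis.

Set Implicit Arguments.
Unset Strict Implicit.
Unset Printing Implicit Defensive.

Import Order.TTheory GRing.Theory Num.Theory.
Import numFieldNormedType.Exports.

Local Open Scope classical_set_scope.
Local Open Scope complex_scope.
Local Open Scope ring_scope.

Reserved Notation "x ** y" (at level 40, left associativity).

(* The complex numbers are R[i] for R : realType. The multiplication is not
   the one of GRing.Algebra because no unit is assumed. *)
HB.mixin Record Lmodule_isStarAlgebra (R : realType) A
    & GRing.Lmodule R[i] A := {
  amul : A -> A -> A ;
  star : A -> A ;
  amulA : associative amul ;
  amulDl : forall x y z, amul (x + y) z = amul x z + amul y z ;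
  amulDr : forall x y z, amul x (y + z) = amul x y + amul x z ;
  amulZl : forall (c : R[i]) x y, amul (c *: x) y = c *: amul x y ;
  amulZr : forall (c : R[i]) x y, amul x (c *: y) = c *: amul x y ;
  starK : involutive star ;
  starD : forall x y, star (x + y) = star x + star y ;
  starZ : forall (c : R[i]) x, star (c *: x) = conjc c *: star x ;
  starM : forall x y, star (amul x y) = amul (star y) (star x)
}.

#[short(type="starAlgType")]
HB.structure Definition StarAlgebra (R : realType) :=
  {A of GRing.Lmodule R[i] A & Lmodule_isStarAlgebra R A}.

Notation "x ** y" := (amul x y) : ring_scope.

HB.mixin Record StarAlgebra_isTopological (R : realType) A
    & Topological A & StarAlgebra R A := {
  amul_continuous : continuous (fun xy : A * A => xy.1 ** xy.2) ;
  star_continuous : continuous (star : A -> A)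
}.

#[short(type="topStarAlgType")]
HB.structure Definition TopStarAlgebra (R : realType) :=
  {A of TopologicalLmodule R[i] A & StarAlgebra R A
      & StarAlgebra_isTopological R A}.

Section StarAlgebras.
Context (R : realType).

Definition projection (A : starAlgType R) (g : A) : Prop :=
  star g = g /\ g ** g = g.

Definition right_annihilator (A : starAlgType R) (S : set A) : set A :=
  [set x | forall s, S s -> s ** x = 0].

Definition Baer_star_algebra (A : starAlgType R) : Prop :=
  forall S : set A, S !=set0 ->
    exists2 g : A, projection g & right_annihilator S = range (amul g).

Record Cstar_seminorm (A : starAlgType R) (p : A -> R) : Prop := {
  Cstar_seminorm_ge0 : forall x, 0 <= p x ;
  Cstar_seminormD : forall x y, p (x + y) <= p x + p y ;
  Cstar_seminormZ : forall (c : R[i]) x, p (c *: x) = Normc.normc c * p x ;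
  Cstar_seminormM : forall x y, p (x ** y) <= p x * p y ;
  Cstar_seminorm_star : forall x, p (star x ** x) = p x ^+ 2
}.

Definition norm_complete (A : starAlgType R) (p : A -> R) : Prop :=
  forall u : nat -> A,
    (forall e : R, 0 < e -> exists N : nat, forall m n : nat,
      (N <= m)%N -> (N <= n)%N -> p (u m - u n) < e) ->
    exists l : A, (fun n => p (u n - l)) @ \oo --> (0 : R).

Record Cstar_algebra (A : starAlgType R) (nrm : A -> R) : Prop := {
  Cstar_algebra_norm : Cstar_seminorm nrm ;
  Cstar_algebra_norm0 : forall x, nrm x = 0 -> x = 0 ;
  Cstar_algebra_complete : norm_complete nrm
}.

Definition AWstar_algebra (A : starAlgType R) (nrm : A -> R) : Prop :=
  Cstar_algebra nrm /\ Baer_star_algebra A.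

Definition saturated (T : Type) (P : set (T -> R)) : Prop :=
  forall p q, P p -> P q -> P (fun x => Num.max (p x) (q x)).

Definition separating (A : zmodType) (P : set (A -> R)) : Prop :=
  forall x, (forall p, P p -> p x = 0) -> x = 0.

(* Meaningful for any family P; if P is nonempty and saturated then n = 1
   suffices. *)
Definition generates_topology (A : topStarAlgType R) (P : set (A -> R)) :=
  forall (x : A) (U : set A), nbhs x U <->
    exists (n : nat) (p : 'I_n -> A -> R) (e : R),
      [/\ 0 < e, (forall i, P (p i))
        & [set y | forall i, p i (y - x) < e] `<=` U].

(* Completeness for the translation-invariant uniformity of A, which is not
   part of a topologicalLmodType. *)
Definition cauchy_filter (A : topStarAlgType R) (F : set_system A) : Prop :=
  (fun xy : A * A => xy.1 - xy.2) @ (F, F) --> (0 : A).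

Record locally_Cstar_algebra (A : topStarAlgType R) : Prop := {
  locally_Cstar_complete :
    forall F : set_system A, ProperFilter F -> cauchy_filter F ->
      exists l : A, F --> l ;
  locally_Cstar_hausdorff : hausdorff_space A ;
  locally_Cstar_generated : exists P : set (A -> R),
    [/\ P `<=` [set p | Cstar_seminorm p], saturated P, separating P
      & generates_topology P]
}.

Definition locally_AWstar_algebra (A : topStarAlgType R) : Prop :=
  locally_Cstar_algebra A /\ Baer_star_algebra A.

Definition continuous_Cstar_seminorms (A : topStarAlgType R) : set (A -> R) :=
  [set p | Cstar_seminorm p /\ continuous p].

Definition norm_oo (A : topStarAlgType R) (a : A) : \bar R :=
  ereal_sup [set (p a)%:E | p in @continuous_Cstar_seminorms A].

Definition bounded_elements (A : topStarAlgType R) : set A :=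
  [set a | (norm_oo a < +oo)%E].

End StarAlgebras.

Arguments bounded_elements {R} A.
Arguments continuous_Cstar_seminorms {R} A.
Arguments norm_oo {R A} a.

Section BoundedClosed.
Context (R : realType) (A : topStarAlgType R).
Implicit Types (x y : A) (p : A -> R).

Lemma bounded_elementsP x : bounded_elements A x <->
  exists M : R, forall p, continuous_Cstar_seminorms A p -> p x <= M.
Proof.
rewrite /bounded_elements /norm_oo /=; split=> [xoo|[M xM]].
  exists (fine (ereal_sup [set (p x)%:E | p in continuous_Cstar_seminorms A])).
  move=> p Np.
  have px : ((p x)%:E <= ereal_sup
      [set (p x)%:E | p in continuous_Cstar_seminorms A])%E.
    by apply: ereal_sup_ubound; exists p.
  rewrite -lee_fin fineK// ge0_fin_numE//.
  by apply: le_trans px; rewrite lee_fin; exact: (Cstar_seminorm_ge0 Np.1).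
apply: (@le_lt_trans _ _ M%:E); last exact: ltry.
by apply: ge_ereal_sup => _ [p Np <-]; rewrite lee_fin; exact: xM.
Qed.

Lemma Cstar_seminorm_starE p x : Cstar_seminorm p -> p (star x) = p x.
Proof.
move=> Hp.
have le y : p y <= p (star y).
  have := Cstar_seminormM Hp (star y) y.
  rewrite (Cstar_seminorm_star Hp) expr2.
  have := Cstar_seminorm_ge0 Hp y; rewrite le_eqVlt => /orP[/eqP <- _|y0].
    exact: Cstar_seminorm_ge0 Hp _.
  by rewrite ler_pM2r.
by apply/eqP; rewrite eq_le le andbT; have := le (star x); rewrite starK.
Qed.

Lemma bounded0 : bounded_elements A 0.
Proof.
apply/bounded_elementsP; exists 0 => p [Hp _].
by rewrite -(scale0r (0 : A)) (Cstar_seminormZ Hp) Normc.normc0 mul0r.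
Qed.

Lemma boundedD x y : bounded_elements A x -> bounded_elements A y ->
  bounded_elements A (x + y).
Proof.
move=> /bounded_elementsP[M xM] /bounded_elementsP[N yN].
apply/bounded_elementsP; exists (M + N) => p Np.
by apply: le_trans (Cstar_seminormD Np.1 _ _) _; rewrite lerD ?xM ?yN.
Qed.

Lemma boundedZ (c : R[i]) x : bounded_elements A x ->
  bounded_elements A (c *: x).
Proof.
move=> /bounded_elementsP[M xM].
apply/bounded_elementsP; exists (Normc.normc c * M) => p Np.
rewrite (Cstar_seminormZ Np.1) ler_wpM2l ?xM//.
by case: c => a b; rewrite sqrtr_ge0.
Qed.

Lemma boundedM x y : bounded_elements A x -> bounded_elements A y ->
  bounded_elements A (x ** y).
Proof.
move=> /bounded_elementsP[M xM] /bounded_elementsP[N yN].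
apply/bounded_elementsP; exists (M * N) => p Np.
apply: le_trans (Cstar_seminormM Np.1 _ _) _.
by apply: ler_pM; rewrite ?xM ?yN//; exact: Cstar_seminorm_ge0 Np.1 _.
Qed.

Lemma bounded_star x : bounded_elements A x -> bounded_elements A (star x).
Proof.
move=> /bounded_elementsP[M xM]; apply/bounded_elementsP; exists M => p Np.
by rewrite (Cstar_seminorm_starE _ Np.1) xM.
Qed.

Definition bounded_pred : {pred A} := [pred a | a \in bounded_elements A].

Lemma bounded_predP x : reflect (bounded_elements A x) (x \in bounded_pred).
Proof. by apply: (iffP idP); rewrite !inE. Qed.

Lemma bounded_submod_closed : submod_closed bounded_pred.
Proof.
split=> [|c x y /bounded_predP bx /bounded_predP by_]; apply/bounded_predP.
  exact: bounded0.
by apply: boundedD => //; exact: boundedZ.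
Qed.

HB.instance Definition _ :=
  GRing.isSubmodClosed.Build R[i] A bounded_pred bounded_submod_closed.

End BoundedClosed.

Record bounded_part (R : realType) (A : topStarAlgType R) := BoundedPart {
  bounded_part_val :> A ;
  bounded_part_valP : bounded_part_val \in @bounded_pred R A
}.

Section BoundedPart.
Context (R : realType) (A : topStarAlgType R).
Notation bA := (bounded_part A).

HB.instance Definition _ := [isSub for @bounded_part_val R A].
HB.instance Definition _ := [Choice of bA by <:].
HB.instance Definition _ := [SubChoice_isSubLmodule of bA by <:].

Lemma bounded_part_elt (x : bA) : bounded_elements A (val x).
Proof. exact/bounded_predP/valP. Qed.

Definition bounded_amul (x y : bA) : bA := BoundedPart
  (introT (bounded_predP _) (boundedM (bounded_part_elt x) (bounded_part_elt y))).

Definition bounded_part_star (x : bA) : bA := BoundedPart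
  (introT (bounded_predP _) (bounded_star (bounded_part_elt x))).

Let bmulA : associative bounded_amul.
Proof. by move=> x y z; apply: val_inj; exact: amulA. Qed.
Let bmulDl x y z :
  bounded_amul (x + y) z = bounded_amul x z + bounded_amul y z.
Proof. by apply: val_inj; exact: amulDl. Qed.
Let bmulDr x y z :
  bounded_amul x (y + z) = bounded_amul x y + bounded_amul x z.
Proof. by apply: val_inj; exact: amulDr. Qed.
Let bmulZl (c : R[i]) x y :
  bounded_amul (c *: x) y = c *: bounded_amul x y.
Proof. by apply: val_inj; exact: amulZl. Qed.
Let bmulZr (c : R[i]) x y :
  bounded_amul x (c *: y) = c *: bounded_amul x y.
Proof. by apply: val_inj; exact: amulZr. Qed.
Let bstarK : involutive bounded_part_star.
Proof. by move=> x; apply: val_inj; exact: starK. Qed.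
Let bstarD x y : bounded_part_star (x + y) =
  bounded_part_star x + bounded_part_star y.
Proof. by apply: val_inj; exact: starD. Qed.
Let bstarZ (c : R[i]) x :
  bounded_part_star (c *: x) = conjc c *: bounded_part_star x.
Proof. by apply: val_inj; exact: starZ. Qed.
Let bstarM x y : bounded_part_star (bounded_amul x y) =
  bounded_amul (bounded_part_star y) (bounded_part_star x).
Proof. by apply: val_inj; exact: starM. Qed.

HB.instance Definition _ := Lmodule_isStarAlgebra.Build R bA
  bmulA bmulDl bmulDr bmulZl bmulZr bstarK bstarD bstarZ bstarM.

(* norm_oo is finite and nonnegative on the bounded part, so fine loses
   nothing here. *)
Definition bounded_part_norm (a : bA) : R := fine (norm_oo (val a)).

End BoundedPart.

Arguments locally_AWstar_algebra {R} A.
Arguments bounded_part {R} A.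
Arguments bounded_part_norm {R} A a.

(* Main.v *)
Require Import Defs.
From mathcomp Require Import all_boot all_order all_algebra.
From mathcomp Require Import complex.
From mathcomp Require Import all_classical all_reals all_analysis.
From mathcomp Require Import lra.

Set Implicit Arguments.
Unset Strict Implicit.
Unset Printing Implicit Defensive.

Import Order.TTheory GRing.Theory Num.Theory.
Import numFieldNormedType.Exports.

Local Open Scope classical_set_scope.
Local Open Scope complex_scope.
Local Open Scope ring_scope.

(** That the bounded part is an AW*-algebra is soft. A sequence that is Cauchy
    for the supremum norm is Cauchy for every continuous C*-seminorm, uniformly
    in the seminorm, so its limit in [A] is bounded and is a limit for the
    supremum norm. A C*-seminorm takes only the values 0 and 1 on projections,
    so the projection that generates an annihilator in [A] is bounded, and it
    generates the annihilator in the bounded part too.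

    Density is the analytic part. The annihilator of {0} is [A], so the Baer
    property provides a unit [e]. Splitting an element into real and imaginary
    parts, it suffices to approximate a self-adjoint [h]. For a real t > 0 put
    x = t h and let y be the inverse of e + x^2; then h y = x y / t is bounded
    by 1/t under every C*-seminorm, while h - h y = h x (x y) has seminorm at
    most t p(h)^2, hence tends to 0 with t.

    The inverse and the bound come without spectral theory, from one
    inequality: p(x)^2 <= p(x^2 + y^2) for commuting self-adjoint x and y
    ([seminorm_sum_squares]), because x is the real part of the normal element
    x + i y. It is applied to three identities, with s = x^2 in the second:
    - z^2 + (x z)^2 = z (z + x^2 z) shows that e + x^2 is bounded below
      ([seminorm_one_plus_sqr_ge]);
    - (a e - s)^2 + 2 a s = a^2 e + s^2 shows that a e - x^2 has
      seminorm less than 1 + a for a suitable a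
      ([seminorm_shift_sqr]), so a Neumann series inverts e + x^2 up to any
      error in one seminorm ([approx_inverse_one_plus_sqr]);
    - (2 x y)^2 + (y - x^2 y)^2 = (y + x^2 y)^2 bounds x y
      ([seminorm_bounded_transform]).
    The lower bound makes the approximate inverses a Cauchy filter, and its
    limit is the inverse ([inverse_one_plus_sqr]). *)

(** * Star algebras and C*-seminorms *)

Section StarAlgebraTheory.
Context {R : realType} {A : starAlgType R}.
Implicit Types (x y z e : A) (c r : R).

Lemma amul0l x : 0 ** x = 0.
Proof. by rewrite -(scale0r (0 : A)) amulZl !scale0r. Qed.

Lemma amul0r x : x ** 0 = 0.
Proof. by rewrite -(scale0r (0 : A)) amulZr !scale0r. Qed.

Lemma amulNl x y : (- x) ** y = - (x ** y).
Proof. by rewrite -scaleN1r amulZl scaleN1r. Qed.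

Lemma amulNr x y : x ** (- y) = - (x ** y).
Proof. by rewrite -scaleN1r amulZr scaleN1r. Qed.

Lemma amulBl x y z : (x - y) ** z = x ** z - y ** z.
Proof. by rewrite amulDl amulNl. Qed.

Lemma amulBr x y z : x ** (y - z) = x ** y - x ** z.
Proof. by rewrite amulDr amulNr. Qed.

Lemma starN x : star (- x) = - star x.
Proof. by rewrite -scaleN1r starZ rmorphN1 scaleN1r. Qed.

Lemma starB x y : star (x - y) = star x - star y.
Proof. by rewrite starD starN. Qed.

Lemma starZr r x : star (r%:C *: x) = r%:C *: star x.
Proof. by rewrite starZ conjc_real. Qed.

Lemma amul_commM x y z : x ** y = y ** x -> x ** z = z ** x ->
  x ** (y ** z) = (y ** z) ** x.
Proof. by move=> xy xz; rewrite amulA xy -amulA xz amulA. Qed.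

Definition unit_of e :=
  [/\ star e = e, forall x, e ** x = x & forall x, x ** e = x].

(** The annihilator of {0} is the whole algebra, and a self-adjoint left unit is
    also a right unit. *)
Lemma Baer_unit : Baer_star_algebra A -> exists e, unit_of e.
Proof.
move=> /(_ [set 0])[|e [es ee] eR]; first by exists 0.
have el x : e ** x = x.
  have : right_annihilator [set 0] x by move=> _ ->; rewrite amul0l.
  by rewrite eR => -[y _ <-]; rewrite amulA ee.
exists e; split=> // x.
by rewrite -[RHS](starK x) -(el (star x)) starM starK es.
Qed.

(** The approximate inverses of [e + x ** x] are kept self-adjoint and commuting
    with [x]: this is what [seminorm_sum_squares] requires of them. *)
Definition sa_comm x y := star y = y /\ x ** y = y ** x.

End StarAlgebraTheory.

Section SeminormTheory.
Context {R : realType} {A : starAlgType R} {p : A -> R}.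
Hypothesis Hp : Cstar_seminorm p.
Implicit Types (x y z e : A) (c r : R).

Lemma seminormZr r x : p (r%:C *: x) = `|r| * p x.
Proof.
by rewrite (Cstar_seminormZ Hp) /= expr0n/= addr0 sqrtr_sqr.
Qed.

Lemma seminormN x : p (- x) = p x.
Proof.
rewrite -scaleN1r -[(-1 : R[i])](rmorphN1 (real_complex R)).
by rewrite seminormZr normrN1 mul1r.
Qed.

Lemma seminorm0 : p 0 = 0.
Proof.
by rewrite -(scale0r (0 : A)) (Cstar_seminormZ Hp) Normc.normc0 mul0r.
Qed.

Lemma seminormBC x y : p (x - y) = p (y - x).
Proof. by rewrite -seminormN opprB. Qed.

Lemma seminorm_triangle x y z : p (x - z) <= p (x - y) + p (y - z).
Proof. by have := Cstar_seminormD Hp (x - y) (y - z); rewrite addrA subrK. Qed.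

Lemma seminorm_projection x : projection x -> p x <= 1.
Proof.
case=> xs xx; have := Cstar_seminorm_star Hp x; rewrite xs xx => px.
have := Cstar_seminorm_ge0 Hp x; nra.
Qed.

Lemma seminorm_unit e : unit_of e -> p e <= 1.
Proof. by case=> es el _; apply: seminorm_projection; split. Qed.

Lemma seminorm_star x : p (star x) = p x.
Proof.
have le u : p u <= p (star u).
  have := Cstar_seminormM Hp (star u) u; rewrite (Cstar_seminorm_star Hp).
  have := Cstar_seminorm_ge0 Hp u.
  by have := Cstar_seminorm_ge0 Hp (star u); nra.
by apply/eqP; rewrite eq_le le andbT -{2}(starK x) le.
Qed.

Lemma seminorm_sqr x : star x = x -> p (x ** x) = p x ^+ 2.
Proof. by move=> xs; rewrite -(Cstar_seminorm_star Hp) xs. Qed.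

(** [x] is the real part of the normal element [z = x + i y], so that
    [p x <= p z], and [star z ** z = x ** x + y ** y]. *)
Lemma seminorm_sum_squares x y : star x = x -> star y = y ->
  x ** y = y ** x -> p x ^+ 2 <= p (x ** x + y ** y).
Proof.
move=> xs ys xy.
pose z := x + 'i%C *: y.
have zs : star z = x - 'i%C *: y.
  by rewrite starD starZ xs ys -scaleNr; congr (_ + _ *: _); simpc.
have zz : star z ** z = x ** x + y ** y.
  rewrite zs amulDr !amulBl !amulZl !amulZr xy addrA subrK scalerA -expr2.
  by rewrite sqr_i scaleN1r opprK.
have := Cstar_seminorm_star Hp z; rewrite zz => ->.
have : 2 * p x <= 2 * p z.
  rewrite -[in leLHS](@ger0_norm _ 2)// -seminormZr.
  have -> : (2 : R)%:C *: x = z + star z.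
    by rewrite zs addrACA subrr addr0 rmorph_nat scaler_nat mulr2n.
  have := Cstar_seminormD Hp z (star z).
  by rewrite seminorm_star; lra.
have := Cstar_seminorm_ge0 Hp x; nra.
Qed.

Lemma sa_commM x z : star x = x -> sa_comm x z -> star (x ** z) = x ** z.
Proof. by move=> xs [zs xz]; rewrite starM xs zs xz. Qed.

(** Multiplying [z + x ** (x ** z)] by [z] gives the sum of squares
    [z ** z + (x ** z) ** (x ** z)]. *)
Lemma seminorm_one_plus_sqr_ge x z : star x = x -> sa_comm x z ->
  p z <= p (z + x ** (x ** z)).
Proof.
move=> xs xz; have [zs xzC] := xz.
have ws := sa_commM xs xz.
have : p z ^+ 2 <= p (z ** (z + x ** (x ** z))).
  rewrite amulDr [z ** (x ** _)]amulA -[z ** x]xzC.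
  by apply: seminorm_sum_squares; rewrite // amulA xzC.
move/le_trans => /(_ _ (Cstar_seminormM Hp _ _)).
have := Cstar_seminorm_ge0 Hp z.
have := Cstar_seminorm_ge0 Hp (z + x ** (x ** z)); nra.
Qed.

(** For large [a] this makes [p (a e - x ** x)] less than [1 + a], as the
    spectral theorem would. The cross term of the square of [a e - x ** x] is
    cancelled by adding the square of [sqrt (2 a) x]. *)
Lemma seminorm_shift_sqr e x a : unit_of e -> star x = x -> 0 <= a ->
  p (a%:C *: e - x ** x) ^+ 2 <= a ^+ 2 + p x ^+ 4.
Proof.
move=> Ue xs a0; have [es el er] := Ue.
pose s := Num.sqrt (2 * a).
have ss : s * s = 2 * a by rewrite -expr2 sqr_sqrtr// mulr_ge0.
have ws : star (a%:C *: e - x ** x) = a%:C *: e - x ** x.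
  by rewrite starB starZr es starM xs.
have vs : star (s%:C *: x) = s%:C *: x by rewrite starZr xs.
have wv : (a%:C *: e - x ** x) ** (s%:C *: x) =
    (s%:C *: x) ** (a%:C *: e - x ** x).
  rewrite amulBl amulBr !amulZl !amulZr el er amulA; congr (_ - _).
  by rewrite !scalerA mulrC.
have := seminorm_sum_squares ws vs wv.
have -> : (a%:C *: e - x ** x) ** (a%:C *: e - x ** x)
    + (s%:C *: x) ** (s%:C *: x) =
    (a * a)%:C *: e + (x ** x) ** (x ** x).
  rewrite amulBl !amulBr !amulZl !amulZr !el !er !scalerA -!rmorphM ss /=.
  have -> : (2 * a)%:C *: (x ** x) = a%:C *: (x ** x) + a%:C *: (x ** x).
    by rewrite -scalerDl -rmorphD; congr (_%:C *: _); lra.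
  rewrite opprB [X in X + _]addrACA.
  move: (_ *: e) (_ ** (x ** _)) (_ *: (x ** x)) => u v w.
  by rewrite -opprD subrK.
have := Cstar_seminormD Hp ((a * a)%:C *: e) ((x ** x) ** (x ** x)).
rewrite seminormZr seminorm_sqr ?seminorm_sqr//; last by rewrite starM xs.
have := seminorm_unit Ue; rewrite ger0_norm; last by rewrite mulr_ge0.
rewrite -exprM !expr2 => ? ? ?; nra.
Qed.

(** The Neumann series of [(1 + a) e - (a e - x ** x)], whose ratio is less than
    1 by [seminorm_shift_sqr]. Its partial sums are built one term at a time:
    if [d] is the defect of [y], then [y + d / (1 + a)] has defect
    [(a e - x ** x) ** d / (1 + a)]. *)
Lemma approx_inverse_one_plus_sqr e x eps :
  unit_of e -> star x = x -> 0 < eps ->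
  exists2 y, sa_comm x y & p (y + x ** (x ** y) - e) < eps.
Proof.
move=> Ue xs eps0; have [es el er] := Ue.
(* This value makes the bound [a ^ 2 + p x ^ 4] less than [(1 + a) ^ 2]. *)
pose a := p x ^+ 4.
have a0 : 0 <= a by rewrite exprn_ge0 ?(Cstar_seminorm_ge0 Hp).
pose w := a%:C *: e - x ** x.
pose r := p w / (1 + a).
have r0 : 0 <= r by rewrite divr_ge0 ?(Cstar_seminorm_ge0 Hp)// addr_ge0.
have r1 : r < 1.
  rewrite ltr_pdivrMr ?mul1r; last lra.
  have := seminorm_shift_sqr Ue xs a0; rewrite -/w -/a.
  have := Cstar_seminorm_ge0 Hp w; rewrite expr2; nra.
have [n rn] : exists n, r ^+ n < eps.
  have /cvgrPdist_lt /(_ _ eps0) [n _ /(_ n (leqnn n))] :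
      (fun n => r ^+ n) @ \oo --> (0 : R) by apply: cvg_expr; rewrite ger0_norm.
  by rewrite /= sub0r normrN ger0_norm ?exprn_ge0// => rn; exists n.
suff [y xy py] : exists2 y, sa_comm x y & p (e - (y + x ** (x ** y))) <= r ^+ n.
  by exists y => //; rewrite seminormBC (le_lt_trans py).
elim: n {rn} => [|n [y xy py]].
  exists 0.
    split; rewrite ?amul0l ?amul0r//.
    by rewrite -(scale0r (0 : A)) starZ conjc0 !scale0r.
  by rewrite !amul0r addr0 subr0 expr0 seminorm_unit.
have [ys xyC] := xy.
have [d d_def] : exists d, d = e - (y + x ** (x ** y)) by eexists.
have ds : star d = d.
  rewrite d_def starB starD es ys (starM x) xs sa_commM//.
  by rewrite -[(x ** y) ** x]amulA -xyC.
have xd : x ** d = d ** x.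
  rewrite d_def amulBr amulBl el er amulDr amulDl xyC; congr (_ - (_ + _)).
  by rewrite -xyC -!amulA -xyC.
pose b := (1 + a)^-1.
have b0 : 0 <= b by rewrite invr_ge0 addr_ge0.
exists (y + b%:C *: d).
  by split; rewrite ?starD ?starZr ?ys ?ds// amulDr amulDl amulZl amulZr xd xyC.
have -> : e - (y + b%:C *: d + x ** (x ** (y + b%:C *: d))) = b%:C *: (w ** d).
  have wd : w ** d = a%:C *: d - x ** (x ** d).
    by rewrite amulBl amulZl el amulA.
  have dE : d = b%:C *: d + b%:C *: (a%:C *: d).
    have bE : b + b * a = 1.
      by rewrite -{1}(mulr1 b) -mulrDr mulVf// gt_eqF// ltr_pwDl.
    by rewrite scalerA -scalerDl -rmorphM -rmorphD /= bE scale1r.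
  rewrite wd !amulDr !amulZr addrACA opprD addrA -d_def -scalerDr.
  by rewrite scalerBr scalerDr opprD {1}dE addrACA addrN add0r.
rewrite seminormZr ger0_norm// exprS /r -/b mulrAC mulrC.
apply: ler_wpM2r => //.
apply: le_trans (Cstar_seminormM Hp _ _) _.
by rewrite d_def ler_wpM2l ?(Cstar_seminorm_ge0 Hp).
Qed.

(** If [y] inverts [e + x ** x], then with [v = x ** (x ** y)] the unit is
    [(y + v) ** (y + v)], which is the sum of the squares of [2 (x ** y)] and of
    [y - v]. The sharp bound is 1/2. *)
Lemma seminorm_bounded_transform e x y :
  unit_of e -> star x = x -> sa_comm x y ->
  y + x ** (x ** y) = e -> p (x ** y) <= 1.
Proof.
move=> Ue xs xy ke; have [ys xyC] := xy.
have [_ el _] := Ue.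
pose u := x ** y; pose v := x ** u.
have yu : y ** u = u ** y by exact: amul_commM.
have yv : y ** v = v ** y by exact: amul_commM.
have xu : x ** u = u ** x by exact: amul_commM.
have uv : u ** v = v ** u by exact: amul_commM.
have us : star u = u by exact: sa_commM.
have vs : star v = v by rewrite /v (starM x) us xs.
have uu : u ** u = y ** v by rewrite /v amulA -xyC.
have eE : (2 : R)%:C *: ((2 : R)%:C *: (u ** u)) + (y - v) ** (y - v) = e.
  rewrite -[RHS]el.
  rewrite -ke -/u -/v amulBl !amulBr amulDl !amulDr uu -yv.
  move: (y ** y) (y ** v) (v ** v) => {}Y m V.
  rewrite !rmorph_nat !scaler_nat !mulr2n opprB addrACA.
  by rewrite ![m + m + _]addrC !addrA !subrK addrAC.
have := @seminorm_sum_squares ((2 : R)%:C *: u) (y - v).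
rewrite starZr starB us ys vs => /(_ erefl erefl).
rewrite !(amulZl, amulZr) amulBr amulBl yu uv => /(_ erefl).
rewrite eE seminormZr ger0_norm// => pu.
by have := seminorm_unit Ue; have := Cstar_seminorm_ge0 Hp u; nra.
Qed.

End SeminormTheory.

(** * The topology of a locally C*-algebra *)

Section LocallyCstar.
Context {R : realType} {A : topStarAlgType R}.
Implicit Types (x y z e : A) (p q : A -> R).

Local Notation N := (continuous_Cstar_seminorms A).

Lemma continuous_seminorm_zero : N (fun=> 0).
Proof.
split; last by move=> x; exact: cvg_cst.
by split=> *; rewrite ?addr0 ?mulr0 ?expr0n.
Qed.

Lemma continuous_seminorm_max p q : N p -> N q ->
  N (fun x => Num.max (p x) (q x)).
Proof.
move=> [Hp cp] [Hq cq]; split; last first.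
  by move=> x; apply: (@continuous_max R A p q x); [exact: cp|exact: cq].
have p0 := Cstar_seminorm_ge0 Hp; have q0 := Cstar_seminorm_ge0 Hq.
split=> [x|x y|c x|x y|x].
- by rewrite le_max p0.
- rewrite ge_max !(le_trans (Cstar_seminormD _ _ _))//.
  + by rewrite lerD// le_max lexx ?orbT.
  + by rewrite lerD// le_max lexx ?orbT.
- rewrite (Cstar_seminormZ Hp) (Cstar_seminormZ Hq) maxr_pMr//.
  by case: c => a b; rewrite sqrtr_ge0.
- rewrite ge_max !(le_trans (Cstar_seminormM _ _ _))//.
  + by rewrite ler_pM// le_max lexx ?orbT.
  + by rewrite ler_pM// le_max lexx ?orbT.
- rewrite (Cstar_seminorm_star Hp) (Cstar_seminorm_star Hq).
  have := p0 x; have := q0 x; case: (leP (p x) (q x)) => pq ? ?.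
  + by rewrite max_r// lerXn2r.
  + by rewrite max_l// lerXn2r// ltW.
Qed.

(** Basic neighbourhoods are cut out by finitely many seminorms; a dominating
    one reduces them to balls of a single seminorm. *)
Lemma continuous_seminorm_dominates n (p : 'I_n -> A -> R) :
  (forall i, N (p i)) -> exists2 q, N q & forall i x, p i x <= q x.
Proof.
elim: n p => [|n IH] p Np.
  by exists (fun=> 0); [exact: continuous_seminorm_zero|case].
have [q Nq qp] := IH (fun i => p (lift ord0 i)) (fun i => Np _).
exists (fun x => Num.max (p ord0 x) (q x)).
  exact: continuous_seminorm_max.
move=> i x; case: (unliftP ord0 i) => [j|] ->; rewrite le_max ?lexx//.
by rewrite qp orbT.
Qed.

Hypothesis hA : locally_Cstar_algebra A.

Lemma nbhs_seminormP x U : nbhs x U <->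
  exists2 q, N q & exists2 eps, 0 < eps & [set y | q (y - x) < eps] `<=` U.
Proof.
have [P [PC _ _ Pgen]] := locally_Cstar_generated hA.
have PN p : P p -> N p.
  move=> Pp; have Hp := PC _ Pp; split=> // y.
  apply/cvgrPdist_lt => eps eps0 /=; apply/Pgen.
  exists 1%N, (fun=> p), eps; split=> // z /(_ ord0) /=.
  have := seminorm_triangle Hp z y 0; have := seminorm_triangle Hp y z 0.
  by rewrite !subr0 (seminormBC Hp y z) ltr_norml; lra.
split=> [/Pgen[n [p [eps [eps0 Pp pU]]]]|[q [Hq cq] [eps eps0 qU]]].
  have [q Nq pq] := continuous_seminorm_dominates (fun i => PN _ (Pp i)).
  exists q => //; exists eps => // y qy; apply: pU => i.
  exact: le_lt_trans (pq _ _) qy.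
have /cvgrPdist_lt /(_ _ eps0) /Pgen[n [p [d [d0 Pp pd]]]] := cq 0.
apply/Pgen; exists n, p, d; split=> // y py; apply: qU.
have /pd : forall i, p i (y - x - 0) < d by move=> i; rewrite subr0; exact: py.
by rewrite /= (seminorm0 Hq) sub0r normrN ger0_norm// (Cstar_seminorm_ge0 Hq).
Qed.

Lemma seminorm_separated x : (forall q, N q -> q x = 0) -> x = 0.
Proof.
move=> x0; apply: (locally_Cstar_hausdorff hA) => U V.
move=> /nbhs_seminormP[q Nq [eps eps0 qU]] /nbhs_singleton V0.
exists 0; split=> //.
by apply: qU; rewrite /= sub0r (seminormN Nq.1) x0.
Qed.

(** Completeness of [A] stated seminorm by seminorm, for the filter of
    approximate inverses and for sequences in the bounded part. *)
Lemma seminorm_complete (F : set_system A) : ProperFilter F ->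
  (forall q eps, N q -> 0 < eps ->
    exists2 V, F V & forall y z, V y -> V z -> q (y - z) < eps) ->
  exists l, forall q eps, N q -> 0 < eps -> F [set y | q (y - l) < eps].
Proof.
move=> PF FC.
have [l Fl] : exists l : A, F --> l.
  apply: (locally_Cstar_complete hA) => U /nbhs_seminormP[q Nq [eps eps0 qU]].
  have [V FV Vq] := FC q eps Nq eps0.
  exists (V, V) => // -[y z] [/= Vy Vz].
  by apply: qU; rewrite /= subr0; exact: Vq.
exists l => q eps Nq eps0; apply: Fl; apply/nbhs_seminormP.
by exists q => //; exists eps.
Qed.

(** The sets of approximate inverses generate a filter, which is Cauchy because
    [seminorm_one_plus_sqr_ge] controls a difference by its image under the
    multiplication by [e + x ** x]. The equations pass to its limit. *)
Lemma inverse_one_plus_sqr e x : unit_of e -> star x = x ->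
  exists2 y, sa_comm x y & y + x ** (x ** y) = e.
Proof.
move=> Ue xs.
pose B (i : (A -> R) * R) :=
  [set y | sa_comm x y /\ i.1 (y + x ** (x ** y) - e) < i.2].
pose D := [set i : (A -> R) * R | N i.1 /\ 0 < i.2].
have PF : ProperFilter (filter_from D B).
  apply: filter_from_proper; last first.
    move=> [q eps] [/= [Hq _] eps0].
    by have [y xy qy] := approx_inverse_one_plus_sqr Hq Ue xs eps0; exists y.
  apply: filter_from_filter.
    by exists (fun=> 0, 1); split=> /=; [exact: continuous_seminorm_zero|].
  move=> [q eps] [p d] [/= Nq eps0] [/= Np d0].
  exists (fun z => Num.max (q z) (p z), Num.min eps d).
    split=> /=; first exact: continuous_seminorm_max.
    by rewrite lt_min eps0.
  by move=> y [/= xy]; rewrite gt_max !lt_min => /andP[/andP[? _] /andP[_ ?]].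
have FB q eps : N q -> 0 < eps -> filter_from D B (B (q, eps)).
  by move=> Nq eps0; exists (q, eps).
have [q eps Nq eps0|l Fl] := @seminorm_complete _ PF.
  have Hq := Nq.1.
  have e20 : 0 < eps / 2 by lra.
  exists (B (q, eps / 2)); first exact: FB.
  move=> y z [[ys xy] /= qy] [[zs xz] /= qz].
  have xyz : sa_comm x (y - z).
    by split; rewrite ?starB ?ys ?zs// amulBl amulBr xy xz.
  apply: le_lt_trans (seminorm_one_plus_sqr_ge Hq xs xyz) _.
  have -> : y - z + x ** (x ** (y - z)) =
      (y + x ** (x ** y)) - (z + x ** (x ** z)).
    by rewrite !amulBr opprD addrACA.
  have := seminorm_triangle Hq (y + x ** (x ** y)) e (z + x ** (x ** z)).
  by rewrite (seminormBC Hq e) => ?; lra.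
have near q eps : N q -> 0 < eps -> exists y,
    [/\ sa_comm x y, q (y + x ** (x ** y) - e) < eps & q (y - l) < eps].
  move=> Nq eps0.
  have [y [[xy qy] ql]] :=
    filter_ex (filterI (FB q eps Nq eps0) (Fl q eps Nq eps0)).
  by exists y.
have small q z : N q -> (exists M : R, forall eps, 0 < eps -> q z <= M * eps) ->
    q z = 0.
  move=> [Hq _] [M qM]; apply/eqP; rewrite eq_le (Cstar_seminorm_ge0 Hq) andbT.
  rewrite leNgt; apply/negP => qz.
  have M0 : 0 < M by have := qM 1 ltr01; lra.
  have := qM (q z / (2 * M)); rewrite divr_gt0 ?mulr_gt0// => /(_ isT).
  have : q z / (2 * M) * (2 * M) = q z by rewrite divfK// gt_eqF ?mulr_gt0.
  by move: (q z / _) => d; lra.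
exists l.
  split; apply/subr0_eq/seminorm_separated => q Nq;
    apply: small => //; have Hq := Nq.1.
    exists 2 => eps /(near _ _ Nq)[y [[ys _] _ yl]].
    have := seminorm_triangle Hq (star l) y l.
    have -> : star l - y = star (l - y) by rewrite starB ys.
    by rewrite (seminorm_star Hq) (seminormBC Hq l); lra.
  exists (2 * q x) => eps /(near _ _ Nq)[y [[_ xy] _ yl]].
  have := seminorm_triangle Hq (x ** l) (x ** y) (l ** x).
  rewrite {2}xy -amulBr -amulBl.
  have := Cstar_seminormM Hq x (l - y); have := Cstar_seminormM Hq (y - l) x.
  rewrite (seminormBC Hq l); have := Cstar_seminorm_ge0 Hq x; nra.
apply/subr0_eq/seminorm_separated => q Nq; apply: small => //; have Hq := Nq.1.
exists (2 + q x * q x) => eps /(near _ _ Nq)[y [_ ye yl]].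
have := seminorm_triangle Hq (l + x ** (x ** l)) (y + x ** (x ** y)) e.
have -> : l + x ** (x ** l) - (y + x ** (x ** y)) = l - y + x ** (x ** (l - y)).
  by rewrite !amulBr opprD addrACA.
have := Cstar_seminormD Hq (l - y) (x ** (x ** (l - y))).
have := Cstar_seminormM Hq x (x ** (l - y)).
have := Cstar_seminormM Hq x (l - y).
rewrite (seminormBC Hq l); have := Cstar_seminorm_ge0 Hq x.
move: (q (y - l)) (q (x ** (l - y))) (q (x ** _)) (q x) yl => a b c d.
nra.
Qed.

(** The approximation is [h ** y], where [y] inverts [e + x ** x] for [x = t h];
    the error [h ** (x ** (x ** y))] is at most [t * q h ^+ 2]. *)
Lemma bounded_approximation_sa e h q eps : unit_of e -> star h = h -> N q ->
  0 < eps -> exists2 b, bounded_elements A b & q (b - h) < eps.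
Proof.
move=> Ue hs Nq eps0; have Hq := Nq.1; have [_ _ er] := Ue.
have qh0 := Cstar_seminorm_ge0 Hq h.
pose t := eps / (1 + q h ^+ 2).
have den0 : 0 < 1 + q h ^+ 2 by rewrite ltr_pwDl// exprn_ge0.
have t0 : 0 < t by rewrite divr_gt0.
pose x := t%:C *: h.
have xs : star x = x by rewrite starZr hs.
have [y xy ye] := inverse_one_plus_sqr Ue xs.
exists (h ** y).
  apply/bounded_elementsP; exists t^-1 => p [Hp _].
  have := seminorm_bounded_transform Hp Ue xs xy ye.
  by rewrite /x amulZl seminormZr// gtr0_norm// mulrC -ler_pdivlMr// mul1r.
have -> : h ** y - h = - (h ** (x ** (x ** y))).
  by rewrite -[X in _ - X]er -ye amulDr opprD addrA subrr add0r.
rewrite seminormN//; apply: le_lt_trans (Cstar_seminormM Hq _ _) _.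
have := Cstar_seminormM Hq x (x ** y).
have := seminorm_bounded_transform Hq Ue xs xy ye.
rewrite {2}/x (seminormZr Hq) gtr0_norm// => xy1 xxy.
have : q h * q (x ** (x ** y)) <= t * q h ^+ 2.
  rewrite expr2 mulrCA ler_wpM2l// (le_trans xxy)// ler_piMr// mulr_ge0//.
  exact: ltW.
move/le_lt_trans; apply.
by rewrite mulrAC ltr_pdivrMr// ltr_pM2l// ltrDr.
Qed.

Lemma bounded_elements_dense e : unit_of e -> dense (bounded_elements A).
Proof.
move=> Ue U [a Ua] oU.
have /nbhs_seminormP[q Nq [eps eps0 qU]] := open_nbhs_nbhs (conj oU Ua).
have Hq := Nq.1; have e20 : 0 < eps / 2 by lra.
pose h := (2^-1 : R)%:C *: (a + star a).
pose k := (2^-1 : R)%:C *: ('i%C *: (star a - a)).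
have hs : star h = h by rewrite starZr starD starK addrC.
have ks : star k = k.
  by rewrite starZr starZ starB starK -[a - _]opprB scalerN -scaleNr;
    congr (_ *: (_ *: _)); simpc.
have ahk : a = h + 'i%C *: k.
  rewrite /h /k [X in _ = _ + X]scalerA [_ * _%:C]mulrC -scalerA -scalerDr.
  rewrite scalerA -expr2 sqr_i scaleN1r opprB addrACA subrr addr0 -mulr2n.
  rewrite -[a *+ 2]scaler_nat scalerA -(rmorph_nat (real_complex R)).
  by rewrite -rmorphM mulVf// scale1r.
have [b bb qb] := bounded_approximation_sa Ue hs Nq e20.
have [c bc qc] := bounded_approximation_sa Ue ks Nq e20.
exists (b + 'i%C *: c); split; last exact: boundedD (boundedZ _ bc).
apply: qU => /=; rewrite {1}ahk opprD addrACA -scalerBr.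
apply: le_lt_trans (Cstar_seminormD Hq _ _) _.
rewrite (Cstar_seminormZ Hq) /= expr0n expr1n add0r sqrtr1 mul1r; lra.
Qed.

End LocallyCstar.

(** * The bounded part *)

Section BoundedPartTheory.
Context {R : realType} {A : topStarAlgType R}.

Local Notation N := (continuous_Cstar_seminorms A).
Local Notation nrm := (bounded_part_norm A).

Lemma bounded_part_valB (a b : bounded_part A) : val (a - b) = val a - val b.
Proof. exact: raddfB. Qed.

Lemma norm_oo_bounded_part (a : bounded_part A) : norm_oo (val a) = (nrm a)%:E.
Proof.
rewrite fineK// ge0_fin_numE ?(bounded_part_elt a)//.
apply: le_trans (lexx _) (ereal_sup_ubound _).
by exists (fun=> 0); [exact: continuous_seminorm_zero|].
Qed.

Lemma seminorm_le_bounded_part_norm q (a : bounded_part A) :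
  N q -> q (val a) <= nrm a.
Proof.
move=> Nq; rewrite -lee_fin -norm_oo_bounded_part.
by apply: ereal_sup_ubound; exists q.
Qed.

Lemma bounded_part_norm_le (a : bounded_part A) (M : R) :
  (forall q, N q -> q (val a) <= M) -> nrm a <= M.
Proof.
move=> qM; rewrite -lee_fin -norm_oo_bounded_part.
by apply: ge_ereal_sup => _ [q Nq <-]; rewrite lee_fin qM.
Qed.

Lemma bounded_part_norm_ge0 (a : bounded_part A) : 0 <= nrm a.
Proof. exact: (seminorm_le_bounded_part_norm a continuous_seminorm_zero). Qed.

Lemma bounded_part_norm_Cstar : Cstar_seminorm nrm.
Proof.
have le := seminorm_le_bounded_part_norm.
have nrmZ_le (c : R[i]) (x : bounded_part A) :
    nrm (c *: x) <= Normc.normc c * nrm x.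
  apply: bounded_part_norm_le => q Nq; rewrite (Cstar_seminormZ Nq.1).
  by rewrite ler_wpM2l ?le//; case: c => a b; rewrite sqrtr_ge0.
have nrmM (x y : bounded_part A) : nrm (x ** y) <= nrm x * nrm y.
  apply: bounded_part_norm_le => q Nq.
  apply: le_trans (Cstar_seminormM Nq.1 _ _) _.
  by rewrite ler_pM ?le ?(Cstar_seminorm_ge0 Nq.1).
split=> [|x y|c x||x]; first exact: bounded_part_norm_ge0.
- apply: bounded_part_norm_le => q Nq.
  by apply: le_trans (Cstar_seminormD Nq.1 _ _) _; rewrite lerD ?le.
- apply/eqP; rewrite eq_le nrmZ_le /=.
  have [->|c0] := eqVneq c 0.
    by rewrite Normc.normc0 mul0r bounded_part_norm_ge0.
  have nc0 : 0 < Normc.normc c.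
    rewrite lt_neqAle eq_sym (contra_neq _ c0) => [/=|/Normc.eq0_normc//].
    by case: c {c0} => a b; rewrite sqrtr_ge0.
  rewrite mulrC -ler_pdivlMr// mulrC -Normc.normcV.
  by have := nrmZ_le c^-1 (c *: x); rewrite scalerA mulVf// scale1r.
- exact: nrmM.
- have sx : nrm (star x) <= nrm x.
    apply: bounded_part_norm_le => q Nq.
    by rewrite (seminorm_star Nq.1) le.
  apply/eqP; rewrite eq_le; apply/andP; split.
    apply: le_trans (nrmM _ _) _; rewrite expr2.
    by rewrite ler_wpM2r// bounded_part_norm_ge0.
  rewrite -[leRHS]sqr_sqrtr ?bounded_part_norm_ge0//.
  rewrite lerXn2r ?nnegrE ?sqrtr_ge0 ?bounded_part_norm_ge0//.
  apply: bounded_part_norm_le => q Nq.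
  rewrite -[leLHS]ger0_norm ?(Cstar_seminorm_ge0 Nq.1)// -sqrtr_sqr.
  rewrite ler_wsqrtr//.
  by rewrite -(Cstar_seminorm_star Nq.1) (le _ (star x ** x)).
Qed.

Hypothesis hA : locally_Cstar_algebra A.

Lemma bounded_part_norm0 (x : bounded_part A) : nrm x = 0 -> x = 0.
Proof.
move=> x0; apply/val_inj/(seminorm_separated hA) => q Nq; apply/eqP.
rewrite eq_le (Cstar_seminorm_ge0 Nq.1) andbT -x0.
exact: seminorm_le_bounded_part_norm.
Qed.

Lemma bounded_part_complete : norm_complete nrm.
Proof.
move=> u uC.
have [q eps Nq eps0|l Fl] := @seminorm_complete _ _ hA (val \o u @ \oo) _.
  have [n un] := uC _ eps0; exists [set val (u k) | k in [set k | (n <= k)%N]].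
    by exists n => // k /= nk; exists k.
  move=> _ _ [j /= nj <-] [k /= nk <-]; rewrite -bounded_part_valB.
  exact: le_lt_trans (seminorm_le_bounded_part_norm _ Nq) (un _ _ nj nk).
(* The rank [n] does not depend on [q]: convergence is uniform over the
   seminorms. *)
have lim eps : 0 < eps -> exists n, forall m q, (n <= m)%N -> N q ->
    q (val (u m) - l) <= eps.
  move=> eps0; have [n un] := uC _ eps0.
  exists n => m q nm Nq; have Hq := Nq.1; apply/ler_addgt0Pr => d d0.
  have [k _ ku] := Fl q d Nq d0.
  have := ku (maxn n k) (leq_maxr _ _) => /= /ltW qd.
  apply: le_trans (seminorm_triangle Hq _ (val (u (maxn n k))) _) _.
  rewrite lerD// -bounded_part_valB.
  apply: le_trans (seminorm_le_bounded_part_norm _ Nq) (ltW (un _ _ _ _)) => //.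
  exact: leq_maxl.
have bl : bounded_elements A l.
  have [n un] := lim _ ltr01.
  apply/bounded_elementsP; exists (nrm (u n) + 1) => q Nq; have Hq := Nq.1.
  have := seminorm_triangle Hq l (val (u n)) 0.
  rewrite !subr0 (seminormBC Hq l).
  have := un n q (leqnn n) Nq.
  by have := seminorm_le_bounded_part_norm (u n) Nq; lra.
exists (BoundedPart (introT (bounded_predP _) bl)).
apply/cvgrPdist_le => eps /lim[n un]; exists n => // m nm /=.
rewrite sub0r normrN ger0_norm ?bounded_part_norm_ge0//.
by apply: bounded_part_norm_le => q Nq; rewrite bounded_part_valB /= un.
Qed.

Lemma bounded_part_Cstar_algebra : Cstar_algebra nrm.
Proof.
split; [exact: bounded_part_norm_Cstar|exact: bounded_part_norm0|].
exact: bounded_part_complete.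
Qed.

(** An annihilator in the bounded part is the trace of the one in [A], and the
    projection that generates the latter is bounded. *)
Lemma bounded_part_Baer :
  Baer_star_algebra A -> Baer_star_algebra (bounded_part A).
Proof.
move=> BA S [s0 Ss0].
have [|g Pg Sg] := BA (val @` S); first by exists (val s0), s0.
have bg : bounded_elements A g.
  apply/bounded_elementsP; exists 1 => q [Hq _].
  exact: seminorm_projection.
pose g' : bounded_part A := BoundedPart (introT (bounded_predP _) bg).
have ggx x : right_annihilator (val @` S) x <-> g ** x = x.
  rewrite Sg; split=> [[y _ <-]|<-]; last by exists x.
  by rewrite amulA Pg.2.
exists g'; first by split; apply: val_inj; [exact: Pg.1|exact: Pg.2].
apply/seteqP; split=> [x Sx|_ [y _ <-] s Ss].
  exists x => //; apply/val_inj/ggx => _ [s Ss <-].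
  exact: (congr1 val (Sx s Ss)).
apply: val_inj; have /ggx : g ** (g ** val y) = g ** val y.
  by rewrite amulA Pg.2.
by apply; exists s.
Qed.

End BoundedPartTheory.

Theorem theorem3 (R : realType) (A : topStarAlgType R)
    (hA : locally_AWstar_algebra A) :
  AWstar_algebra (bounded_part_norm A) /\ dense (bounded_elements A).
Proof.
have [lA BA] := hA; have [e Ue] := Baer_unit BA.
split; last exact: bounded_elements_dense lA _ Ue.
by split; [exact: bounded_part_Cstar_algebra|exact: bounded_part_Baer].
Qed.
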